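(* Let $X$ be a compact metric space, $f:X\to X$ a continuous map, $\mu$ an $f$-invariant ergodic probability measure on $X$, and $\widehat Y\subset\widehat X$ a Borel set such that $\hat\mu(\widehat Y)>0$ and $h^-_{f,inf,B}(\mu,\hat x)\ge\alpha>0$ for every $\hat x\in\widehat Y$. Then $$\lim_{\delta\to0}\left(\sup\{h^-(\widehat{\mathcal A}):\widehat{\mathcal A}\subset\widehat Y,\ \hat\mu(\widehat Y\setminus\widehat{\mathcal A})<\delta\}\right)\ge\alpha.$$
   Context: Inverse limit: $\widehat X=\{\hat x=(x_0,x_{-1},x_{-2},\ldots): x_{-i}\in X,\ f(x_{-i})=x_{-i+1},\ i\ge1\}$, $\pi(\hat x)=x_0$, $\hat f(x_0,x_{-1},\ldots)=(f(x_0),x_0,x_{-1},\ldots)$; $\hat\mu$ is the unique $\hat f$-invariant ergodic probability measure on $\widehat X$ with $\pi_*\hat\mu=\mu$. Inverse Bowen balls and lower inverse metric entropy at $\hat x$: $B_n^-(\hat x,\varepsilon)=\{y\in X:\exists\,\hat y\in\widehat X,\ y_0=y,\ d(x_{-i},y_{-i})<\varepsilon,\ 0\le i\le n\}$ and $h^-_{f,inf,B}(\mu,\hat x)=\lim_{\varepsilon\to0}\liminf_{n\to\infty}\frac{-\log\mu(B_n^-(\hat x,\varepsilon))}{n}$. Generalized inverse topological entropy: for $\widehat{\mathcal A}\subset\widehat X$ and $\varepsilon>0$ let $\mathcal B^-(\widehat{\mathcal A},\varepsilon)=\{B_m^-(\hat x,\varepsilon):m\ge1,\ \hat x\in\widehat{\mathcal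 A}\}$, and for $B^-=B_m^-(\hat x,\varepsilon)$ write $n(B^-)=m$. For $Y\subset X$, $\lambda\ge0$, $N\ge1$, let $$m_N^-(\lambda,Y,\widehat{\mathcal A},\varepsilon)=\inf\Big\{\sum_{B^-\in\mathcal F}e^{-\lambda n(B^-)}:\mathcal F\subset\mathcal B^-(\widehat{\mathcal A},\varepsilon),\ n(B^-)\ge N\ \forall B^-\in\mathcal F,\ Y\cap\pi(\widehat{\mathcal A})\subset\bigcup_{B^-\in\mathcal F}B^-\Big\},$$ $m^-(\lambda,Y,\widehat{\mathcal A},\varepsilon)=\lim_{N\to\infty}m_N^-(\lambda,Y,\widehat{\mathcal A},\varepsilon)$, $h^-(Y,\widehat{\mathcal A},\varepsilon)=\inf\{\lambda\ge 0:m^-(\lambda,Y,\widehat{\mathcal A},\varepsilon)=0\}$, $h^-(Y,\widehat{\mathcal A})=\lim_{\varepsilon\to0}h^-(Y,\widehat{\mathcal A},\varepsilon)$. For $\widehat{\mathcal A}\subset\widehat X$ put $h^-(\widehat{\mathcal A})=h^-(\pi(\widehat{\mathcal A}),\widehat{\mathcal A})$. The supremum in the claim is over $\hat\mu$-measurable subsets. *)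

(* Defs.v *)
From HB Require Import structures.
From mathcomp Require Import all_boot all_order all_algebra.
From mathcomp Require Import all_classical all_reals all_analysis.

Set Implicit Arguments.
Unset Strict Implicit.
Unset Printing Implicit Defensive.

Import Order.TTheory GRing.Theory Num.Theory.
Import numFieldNormedType.Exports.

Local Open Scope classical_set_scope.
Local Open Scope ring_scope.

(* The measurable spaces of the library are pointed types, so the Borel space of
   a metric space is only available when the metric space carries a point.  The
   point plays no other role. *)
#[short(type="pmetricType")]
HB.structure Definition PointedMetric (R : numDomainType) :=
  {T of Metric R T & Pointed T}.

Notation borel T := (g_sigma_algebraType (@open T)).

(* A point (x_0, x_{-1}, x_{-2}, ...) is encoded by i |-> x_{-i}. *)
Definition inverse_limit (T : topologicalType) (f : T -> T) :
    set (prod_topology (fun _ : nat => T)) :=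
  [set x | forall i, f (x i.+1) = x i].

Definition past (T : topologicalType) (f : T -> T) (i : nat)
  (x : inverse_limit f) : T := \val x i.

Lemma pastS (T : topologicalType) (f : T -> T) (x : inverse_limit f) i :
  f (past i.+1 x) = past i x.
Proof. exact: (set_valP x). Qed.

Definition shift_seq (T : topologicalType) (f : T -> T)
    (x : inverse_limit f) : prod_topology (fun _ : nat => T) :=
  fun i => if i is j.+1 then past j x else f (past 0 x).

Lemma shift_seqP (T : topologicalType) (f : T -> T) (x : inverse_limit f) :
  shift_seq x \in inverse_limit f.
Proof. by rewrite inE => -[|i] //=; rewrite pastS. Qed.

Definition inverse_limit_map (T : topologicalType) (f : T -> T) (x : inverse_limit f) :
  inverse_limit f := SigSub (shift_seqP x).

Lemma inverse_limit_nonempty (T : ptopologicalType) (f : T -> T) :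
  hausdorff_space T -> compact [set: T] -> continuous f ->
  exists x, x \in inverse_limit f.
Proof.
move=> hT cT cf; pose S := prod_topology (fun _ : nat => T).
pose p n : S := fun i => iter (n - i) f point.
have cS : compact [set x : S | forall i, [set: T] (x i)].
  exact: (@tychonoff nat (fun=> T) (fun=> setT) (fun=> cT)).
have pF : ProperFilter (p @ \oo) by exact: fmap_proper_filter.
have [x [_ px]] := cS _ pF (@filterE _ _ _ _ (fun _ _ => I)).
have projc j : continuous (fun y : S => y j).
  exact: (@proj_continuous nat (fun=> T) j).
exists x; rewrite inE => i.
apply: (hT (f (x i.+1)) (x i)) => A B fxA xB.
have xA : nbhs (x : S) [set y : S | A (f (y i.+1))].
  exact: (@continuous_comp _ _ _ (fun y : S => y i.+1) f x (projc _ _) (cf _)).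
have pi : (p @ \oo) [set y : S | f (y i.+1) = y i].
  by exists i.+1 => // n /= ni; rewrite /p -iterS subnSK.
have [y [/= fy [Ay By]]] := px _ _ pi (filterI xA (projc i x _ xB)).
by exists (y i); split => //; rewrite -fy.
Qed.

(* The inverse limit as a pointed type.  The compactness of X and the continuity
   of f are arguments because they are what provides a point. *)
Definition natural_extension (R : realType) (X : pmetricType R) (f : X -> X)
  (cX : compact [set: X]) (cf : continuous f) : Type := inverse_limit f.

Section natural_extension_instances.
Context (R : realType) (X : pmetricType R) (f : X -> X).
Context (cX : compact [set: X]) (cf : continuous f).

HB.instance Definition _ := Topological.on (natural_extension cX cf).

Let nonempty := inverse_limit_nonempty (@metric_hausdorff R X) cX cf.

HB.instance Definition _ := isPointed.Build (natural_extension cX cf)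
  (SigSub (xchooseP nonempty) : inverse_limit f).

End natural_extension_instances.

Section dynamics.
Context d (T : measurableType d) (R : realType).

Definition invariant_measure (m : set T -> \bar R) (g : T -> T) :=
  forall A, measurable A -> m (g @^-1` A) = m A.

Definition ergodic_measure (m : set T -> \bar R) (g : T -> T) :=
  forall A, measurable A -> g @^-1` A = A -> m A = 0%E \/ m A = 1%E.

End dynamics.

Section inverse_entropy.
Context (R : realType) (X : metricType R) (f : X -> X).
Local Open Scope ereal_scope.

Definition inverse_bowen_ball (n : nat) (x : inverse_limit f) (e : R) : set X :=
  [set y | exists z : inverse_limit f, past 0 z = y /\
     forall i, (i <= n)%N -> (mdist (past i x) (past i z) < e)%R].

(* lne is -oo at 0, so that - log 0 = +oo.  The junk value at n = 0 does not
   affect the liminf. *)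
Definition lower_inverse_entropy (mu : set X -> \bar R) (x : inverse_limit f) :
    \bar R :=
  lim (limn_einf (fun n => - lne (mu (inverse_bowen_ball n x e)) / n%:R%:E)
       @[e --> (0%R : R)^'+]).

(* A ball is paired with its length m, since the same subset of X may be
   B_m^-(x, e) for several m. *)
Definition inverse_balls (A : set (inverse_limit f)) (e : R) :
    set (nat * set X) :=
  [set B | exists m x, [/\ (1 <= m)%N, A x & B = (m, inverse_bowen_ball m x e)]].

Definition inverse_cover_sum (N : nat) (lambda : R) (Y : set X)
    (A : set (inverse_limit f)) (e : R) : \bar R :=
  ereal_inf [set \esum_(B in F) (expR (- lambda * B.1%:R))%:E |
    F in [set F | [/\ F `<=` inverse_balls A e,
                      forall B, F B -> (N <= B.1)%N &
                      Y `&` past 0 @` A `<=` \bigcup_(B in F) B.2]]].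

Definition inverse_cover_measure (lambda : R) (Y : set X)
    (A : set (inverse_limit f)) (e : R) : \bar R :=
  limn (fun N => inverse_cover_sum N lambda Y A e).

Definition inverse_entropy_at (Y : set X) (A : set (inverse_limit f)) (e : R) :
    \bar R :=
  ereal_inf [set lambda%:E | lambda in
    [set lambda | (0 <= lambda)%R /\ inverse_cover_measure lambda Y A e = 0]].

Definition inverse_entropy (Y : set X) (A : set (inverse_limit f)) : \bar R :=
  lim (inverse_entropy_at Y A e @[e --> (0%R : R)^'+]).

Definition generalized_inverse_entropy (A : set (inverse_limit f)) : \bar R :=
  inverse_entropy (past 0 @` A) A.

End inverse_entropy.

(* Main.v *)
(* Fix c < alpha. Since the entropy of x in Y exceeds c, the sets
   G_k = {x | mu (B_n^-(x, 1/(k+1))) <= exp (- c n) for all n >= k, n > 0}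
   increase to a set containing Y, so A = Y `&` G_k leaves less than delta of Y
   for k large, and has positive measure. The set G_k is closed because
   x |-> mu (B_n^-(x, e)) is lower semicontinuous, so A is even Borel. A cover of
   pi(A) by balls of radius 1/(k+1) centred in A and of lengths m >= k then satisfies
   sum exp (- lambda m) >= sum mu (B) >= mu (bigcup B) >= muhat(A) > 0 whenever
   lambda <= c (mass distribution), hence h^-(A) >= c. *)
Require Import Defs.
From HB Require Import structures.
From mathcomp Require Import all_boot all_order all_algebra.
From mathcomp Require Import all_classical all_reals all_analysis measurable_realfun.
From mathcomp Require Import finmap.

Set Implicit Arguments.
Unset Strict Implicit.
Unset Printing Implicit Defensive.

Import Order.TTheory GRing.Theory Num.Theory.
Import numFieldNormedType.Exports.

Local Open Scope classical_set_scope.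
Local Open Scope ring_scope.

(** * Monotone limits at 0, lower limits and exponential rates *)

Section right_limits.
Context (R : realType).
Implicit Types (g : R -> \bar R) (c : \bar R).
Local Open Scope ereal_scope.

(** Monotonicity guarantees that the limit exists, so [lim] is not a default value. The limits in
    the radius become suprema through this form; the limit in [delta] becomes an infimum through the
    dual one. *)
Lemma nonincreasing_at_right0_lim g :
  (forall e e', (0 < e)%R -> (e <= e')%R -> g e' <= g e) ->
  lim (g e @[e --> (0%R : R)^'+]) = ereal_sup [set g e | e in [set e | (0 < e)%R]].
Proof.
move=> gE; apply/cvg_lim => //.
have -> : [set e : R | (0 < e)%R] = [set` Interval (BRight (0%R : R)) +oo%O].
  by apply/seteqP; split=> e /=; rewrite in_itv/= andbT.
apply: nonincreasing_at_right_cvge => // x y; rewrite !in_itv/= !andbT => x0 _.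
exact: gE.
Qed.

Lemma nondecreasing_at_right0_lim g :
  (forall e e', (0 < e)%R -> (e <= e')%R -> g e <= g e') ->
  lim (g e @[e --> (0%R : R)^'+]) = ereal_inf [set g e | e in [set e | (0 < e)%R]].
Proof.
move=> gE; apply/cvg_lim => //.
have -> : [set e : R | (0 < e)%R] = [set` Interval (BRight (0%R : R)) +oo%O].
  by apply/seteqP; split=> e /=; rewrite in_itv/= andbT.
apply: nondecreasing_at_right_cvge => // x y; rewrite !in_itv/= !andbT => x0 _.
exact: gE.
Qed.

Lemma le_limn_einf (u v : (\bar R)^nat) :
  (forall n, u n <= v n) -> limn_einf u <= limn_einf v.
Proof.
move=> uv; rewrite !limn_einf_lim; apply: lee_lim.
- exact: is_cvg_einfs.
- exact: is_cvg_einfs.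
apply: nearW => n; apply: le_ereal_inf_tmp => _ [m/= nm <-].
by apply: le_trans (uv m); apply: ereal_inf_lbound; exists m.
Qed.

Lemma lt_limn_einf (u : (\bar R)^nat) c : c < limn_einf u ->
  exists N, forall n, (N <= n)%N -> c < u n.
Proof.
rewrite limn_einf_lim (cvg_lim _ (@cvg_einfs_sup _ u))// => /ereal_sup_gt[_ [N _ <-]].
move=> cN; exists N => n Nn; apply: (lt_le_trans cN).
by apply: ereal_inf_lbound; exists n.
Qed.

Lemma lneN_div_gt (m : \bar R) (c : R) n : (0 < n)%N -> 0 <= m ->
  c%:E < - lne m / n%:R%:E -> m <= (expR (- (c * n%:R)))%:E.
Proof.
move=> n0; have n0' : (0 < n%:R :> R)%R by rewrite ltr0n.
(* For [m = +oo] the quotient is [-oo], which contradicts the assumption; [m = 0] makes the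
   conclusion immediate. *)
case: m => [r| |]//; last first.
  by rewrite /= inver gt_eqF// mulNyr gtr0_sg ?invr_gt0// mul1e ltNge leNye.
rewrite lee_fin le_eqVlt => /predU1P[<- _|r0]; first by rewrite lee_fin expR_ge0.
rewrite inver gt_eqF// lne_EFin// lte_pdivlMr// -EFinN -EFinM lte_fin => cr.
by rewrite lee_fin -[leLHS]lnK ?posrE// ler_expR ltW// ltrNr.
Qed.

End right_limits.

(** * Sums over arbitrary index sets *)

Section esum_lemmas.
Context (R : realType).
Local Open Scope ereal_scope.

Lemma subset_esum (T : choiceType) (S S' : set T) (a : T -> \bar R) :
  S `<=` S' -> \esum_(i in S) a i <= \esum_(i in S') a i.
Proof.
move=> SS'; apply: ereal_sup_le => _ [X [finX XS] <-].
by exists X => //; split=> // x /XS /SS'.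
Qed.

(** A right inverse [psi] of [phi] on the image is injective there and takes values in [F], so the
    left side is a sum over a subset of [F]. *)
Lemma esum_image_le (T T' : choiceType) (F : set T) (phi : T -> T')
    (a : T' -> \bar R) :
  \esum_(y in phi @` F) a y <= \esum_(x in F) a (phi x).
Proof.
have [->|/set0P[t0 _]] := eqVneq F set0; first by rewrite image_set0 !esum_set0.
have /choice[psi psiP] (y : T') : exists x, (phi @` F) y -> F x /\ phi x = y.
  have [[x Fx <-]|nFy] := pselect ((phi @` F) y); first by exists x.
  by exists t0.
rewrite [leLHS](eq_esum (b := fun y => a (phi (psi y)))); last first.
  by move=> y /psiP[_ ->].
rewrite -(esum_image (phi @` F) psi (a \o phi)); last first.
  move=> y y' /set_mem/psiP[_ {2}<-] /set_mem/psiP[_ {2}<-] ->//.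
by apply: subset_esum => _ [y /psiP[Fy _] <-].
Qed.

Lemma esum_cst_finite (T : choiceType) (S : set T) (c : R) : (0 < c)%R ->
  \esum_(i in S) c%:E < +oo -> finite_set S.
Proof.
move=> c0 Soo; apply: contrapT => infS.
suff : \esum_(i in S) c%:E = +oo by move: Soo => /[swap] ->; rewrite ltxx.
(* At least [A / c] elements of weight [c] sum to at least [A], for any [A]. *)
apply/eqyP => A A0; have [B BS AB] := infinite_set_fset (Num.bound (A / c)%R) infS.
apply: esum_ge; exists [set` B]; first by split.
rewrite fsbig_finite//= set_fsetK sumEFin lee_fin big_const_seq count_predT.
rewrite iter_addr addr0 -mulr_natl -ler_pdivrMr//.
rewrite (le_trans (ltW (archi_boundP _)))//; first by rewrite divr_ge0// ltW.
by rewrite ler_nat.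
Qed.

(* Finiteness of the sum leaves finitely many indices of each level, so F is
   countable. *)
Lemma measure_bigcup_le_esum_levels d (T : measurableType d)
    (mu : {measure set T -> \bar R}) (I : choiceType) (F : set I)
    (level : I -> nat) (B : I -> set T) (w : nat -> R) :
  (forall n, (0 < w n)%R) ->
  (forall i, F i -> measurable (B i)) ->
  (forall i, F i -> mu (B i) <= (w (level i))%:E) ->
  \esum_(i in F) (w (level i))%:E < +oo ->
  measurable (\bigcup_(i in F) B i) /\
  mu (\bigcup_(i in F) B i) <= \esum_(i in F) (w (level i))%:E.
Proof.
move=> w0 mB muB Foo; pose J n := F `&` [set i | level i = n].
have FJ : F = \bigcup_n J n.
  by apply/seteqP; split=> [i Fi|i [n _ []]//]; exists (level i).
have finJ n : finite_set (J n).
  apply: (@esum_cst_finite _ _ (w n)) => //; apply: le_lt_trans Foo.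
  rewrite [leLHS](eq_esum (b := fun i => (w (level i))%:E)); last by move=> i [_ /= ->].
  by apply: subset_esum => i [].
have mJ n : measurable (\bigcup_(i in J n) B i).
  by apply: fin_bigcup_measurable => // i [Fi _]; exact: mB.
have FE : \bigcup_(i in F) B i = \bigcup_n \bigcup_(i in J n) B i.
  rewrite {1}FJ; apply/seteqP; split=> [x [i [n _ Ji] Bx]|x [n _ [i Ji Bx]]].
    by exists n => //; exists i.
  by exists i => //; exists n.
have mF : measurable (\bigcup_(i in F) B i) by rewrite FE; exact: bigcup_measurable.
split=> //.
(* The levels [J n] are disjoint, so the sum splits into a series over [n]. Countable subadditivity
   across levels and finite subadditivity within each then give the bound. *)
rewrite [leRHS](_ : _ = \sum_(n <oo) \esum_(i in J n) (w (level i))%:E); last first.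
  rewrite {1}FJ esum_bigcupT; last first.
  - by move=> i; rewrite lee_fin ltW.
  - by move=> m n _ _ [i [[_ /= <-] [_ /= <-]]].
  by rewrite nneseries_esumT// => n; apply: esum_ge0 => i _; rewrite lee_fin ltW.
apply: le_trans (measure_sigma_subadditive mu mJ mF _) _; first by rewrite FE; exact: subset_refl.
apply: lee_nneseries => // n _; rewrite esum_fset//; last first.
  by move=> i _; rewrite lee_fin ltW.
apply: le_trans (content_sub_fsum _ (finJ n) _ (mJ n) (@subset_refl _ _)) _.
  by move=> i [Fi _]; exact: mB.
by apply: lee_fsum => // i [Fi _]; exact: muB.
Qed.

End esum_lemmas.

(** * Topology of the inverse limit *)

Section inverse_limit_topology.
Context (T : topologicalType) (f : T -> T).

Lemma past_continuous i : continuous (past i : inverse_limit f -> T).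
Proof.
move=> x; apply: (@continuous_comp _ _ _ (set_val : inverse_limit f -> _)
  (fun y : prod_topology (fun _ : nat => T) => y i)).
  exact: initial_continuous.
exact: (@proj_continuous nat (fun=> T) i).
Qed.

(** For [x] in the closure, any neighbourhoods of [f (x i.+1)] and [x i] share a point
    [f (y i.+1) = y i] with [y] in the inverse limit; Hausdorff separation forces equality. *)
Lemma closed_inverse_limit : hausdorff_space T -> continuous f ->
  closed (inverse_limit f).
Proof.
move=> hT cf x clx i.
have projc j : continuous (fun y : prod_topology (fun _ : nat => T) => y j).
  exact: (@proj_continuous nat (fun=> T) j).
apply: (hT (f (x i.+1)) (x i)) => A B fxA xB.
have xA : nbhs x [set y : prod_topology (fun _ : nat => T) | A (f (y i.+1))].
  exact: (@continuous_comp _ _ _ (fun y : prod_topology (fun _ : nat => T) => y i.+1) f x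
    (projc _ _) (cf _)).
have [y [/= fy [Ay By]]] := clx _ (filterI xA (projc i x _ xB)).
by exists (y i); split => //; rewrite -(fy i).
Qed.

End inverse_limit_topology.

(** * Measurability and semicontinuity for inverse Bowen balls *)

Section inverse_bowen_balls.
Context (R : realType) (X : pmetricType R) (f : X -> X).
Hypotheses (cX : compact [set: X]) (cf : continuous f).
Implicit Types (x : inverse_limit f) (e r : R).

Lemma closed_le_mdist (a : X) r : closed [set y | mdist a y <= r].
Proof.
move=> y cly /=; apply/ler_addgt0Pr => e e0.
have [z [/= az yz]] := cly _ (nbhsx_ballx y _ e0).
move: yz; rewrite ballEmdist/= => yz.
by rewrite (le_trans (metric_triangle a z y))// lerD// metric_sym ltW.
Qed.

Definition closed_inverse_bowen_ball n x r : set X :=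
  [set y | exists z : inverse_limit f, past 0 z = y /\
     forall i, (i <= n)%N -> mdist (past i x) (past i z) <= r].

(** The set is the projection to coordinate 0 of a closed subset of the compact product, hence
    compact. *)
Lemma closed_inverse_bowen_ball_closed n x r :
  closed (closed_inverse_bowen_ball n x r).
Proof.
pose S := prod_topology (fun _ : nat => X).
have projc j : continuous (fun y : S => y j).
  exact: (@proj_continuous nat (fun=> X) j).
pose D := inverse_limit f `&`
  \bigcap_(i in `I_n.+1) [set w : S | mdist (past i x) (w i) <= r].
have -> : closed_inverse_bowen_ball n x r = (fun w : S => w 0) @` D.
  apply/seteqP; split=> [y [z [<- xz]]|_ [w [fw xw] <-]].
    by exists (\val z) => //; split; [exact: set_valP|move=> i /= ni; exact: xz].
  by exists (SigSub (mem_set fw)); split.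
apply: compact_closed; first exact: metric_hausdorff.
apply: continuous_compact; first exact/continuous_subspaceT/projc.
apply: (@subclosed_compact S D [set w | forall i, [set: X] (w i)]) => //.
  apply: closedI; first by apply: closed_inverse_limit => //; exact: metric_hausdorff.
  apply: closed_bigI => i _.
  exact: (proj1 (continuous_closedP _) (projc i) _ (@closed_le_mdist _ _)).
exact: (@tychonoff nat (fun=> X) (fun=> setT) (fun=> cX)).
Qed.

(** The projection of an open set of the inverse limit need not be open in [X]; this countable union
    of closed sets is what makes the ball Borel. *)
Lemma inverse_bowen_ball_bigcup n x e :
  inverse_bowen_ball n x e =
  \bigcup_k closed_inverse_bowen_ball n x (e - k.+1%:R^-1).
Proof.
apply/seteqP; split=> [y [z [zy xz]]|y [k _ [z [zy xz]]]]; last first.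
  exists z; split=> // i /xz /le_lt_trans; apply.
  by rewrite ltrBlDr ltrDl invr_gt0.
(* Only the finitely many coordinates [i <= n] are constrained, so one [k] fits below all the
   gaps. *)
have [k _ /(_ k (leqnn k))/= xzk] :
    \forall k \near \oo, forall i : 'I_n.+1,
      mdist (past i x) (past i z) + k.+1%:R^-1 <= e.
  apply: filter_forall => i.
  have d0 : 0 < e - mdist (past i x) (past i z) by rewrite subr_gt0 xz// -ltnS.
  near=> k; rewrite -lerBrDl ltW//.
  by near: k; exact: (near_infty_natSinv_lt (PosNum d0)).
exists k => //; exists z; split=> // i ni; rewrite lerBrDr.
by rewrite -ltnS in ni; exact: (xzk (Ordinal ni)).
Unshelve. all: by end_near. Qed.

Lemma closed_inverse_bowen_ball_measurable n x r :
  measurable (closed_inverse_bowen_ball n x r : set (borel X)).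
Proof.
rewrite -[X in measurable X]setCK; apply: measurableC.
by apply: sub_sigma_algebra; rewrite /= openC; exact: closed_inverse_bowen_ball_closed.
Qed.

Lemma inverse_bowen_ball_measurable n x e :
  measurable (inverse_bowen_ball n x e : set (borel X)).
Proof.
rewrite inverse_bowen_ball_bigcup; apply: bigcup_measurable => k _.
exact: closed_inverse_bowen_ball_measurable.
Qed.

Lemma subset_inverse_bowen_ball n x e e' : e <= e' ->
  inverse_bowen_ball n x e `<=` inverse_bowen_ball n x e'.
Proof.
by move=> ee' y [z [zy xz]]; exists z; split=> // i /xz /lt_le_trans; apply.
Qed.

(* For x' close to x, B_n^-(x', e) contains the closed balls of slightly smaller
   radius around x that exhaust B_n^-(x, e). *)
Lemma open_inverse_bowen_ball_gt (mu : {measure set (borel X) -> \bar R}) n e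
    (c : \bar R) :
  open [set x : inverse_limit f | (c < mu (inverse_bowen_ball n x e))%E].
Proof.
rewrite openE => x /= cx.
(* Continuity of [mu] from below along the exhausting closed balls. *)
have [k cxk] : exists k,
    (c < mu (closed_inverse_bowen_ball n x (e - k.+1%:R^-1)))%E.
  apply: contrapT => /forallNP muc; move: cx; rewrite ltNge => /negP; apply.
  have : (mu \o (fun k => closed_inverse_bowen_ball n x (e - k.+1%:R^-1))) @ \oo
      --> mu (inverse_bowen_ball n x e).
    rewrite inverse_bowen_ball_bigcup; apply: nondecreasing_cvg_mu.
    - by move=> k; exact: closed_inverse_bowen_ball_measurable.
    - by rewrite -inverse_bowen_ball_bigcup; exact: inverse_bowen_ball_measurable.
    - move=> k l kl; apply/subsetPset => y [z [zy xz]]; exists z; split=> // i /xz.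
      move=> /le_trans; apply; rewrite lerB// lef_pV2 ?posrE//.
      by rewrite ler_nat.
  move=> cvmu; rewrite -(cvg_lim _ cvmu)//; apply: lime_le; first exact: cvgP cvmu.
  by apply: nearW => k; rewrite leNgt; apply/negP; exact: muc.
have : \forall x' \near x, forall i : 'I_n.+1,
    mdist (past i x) (past i x') < k.+1%:R^-1.
  apply: (@filter_forall _ 'I_n.+1
    (fun i (x' : inverse_limit f) => mdist (past i x) (past i x') < k.+1%:R^-1) _
    (nbhs_filter x)) => i.
  apply: (@past_continuous _ f i x [set y | mdist (past i x) y < k.+1%:R^-1]).
  have := nbhsx_ballx (past i x) k.+1%:R^-1.
  by rewrite ballEmdist; apply; rewrite invr_gt0.
apply: filterS => x' xx' /=; apply: (lt_le_trans cxk).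
apply: le_measure.
- by apply: mem_set; exact: closed_inverse_bowen_ball_measurable.
- by apply: mem_set; exact: inverse_bowen_ball_measurable.
move=> y [z [zy xz]]; exists z; split=> // i ni.
apply: (le_lt_trans (metric_triangle _ (past i x) _)); rewrite metric_sym.
(* The displacement of the centre uses exactly the margin [k.+1%:R^-1] left by the smaller
   radius. *)
rewrite -[ltRHS](subrKC k.+1%:R^-1) ltr_leD//; last exact: xz.
by rewrite -ltnS in ni; exact: (xx' (Ordinal ni)).
Qed.

End inverse_bowen_balls.

(** * Monotonicity of cover sums and entropy in length and radius *)

Section inverse_entropy_monotone.
Context (R : realType) (X : metricType R) (f : X -> X).
Implicit Types (A : set (inverse_limit f)) (Y : set X) (e lambda : R).
Local Open Scope ereal_scope.

Lemma inverse_cover_sum_ge0 N lambda Y A e : 0 <= inverse_cover_sum N lambda Y A e.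
Proof.
apply: le_ereal_inf_tmp => _ [F _ <-]; apply: esum_ge0 => B _.
by rewrite lee_fin expR_ge0.
Qed.

Lemma inverse_cover_sum_nondecreasing lambda Y A e :
  {homo (fun N => inverse_cover_sum N lambda Y A e) : N N' / (N <= N')%N >-> N <= N'}.
Proof.
move=> N N' NN'; apply: ereal_inf_le_tmp => _ [F [FA FN YF] <-]; exists F => //.
by split=> // B /FN; exact: leq_trans.
Qed.

Lemma inverse_cover_measureE lambda Y A e :
  inverse_cover_measure lambda Y A e =
  ereal_sup (range (fun N => inverse_cover_sum N lambda Y A e)).
Proof.
apply/cvg_lim => //; apply: ereal_nondecreasing_cvgn.
exact: inverse_cover_sum_nondecreasing.
Qed.

Lemma inverse_cover_measure_ge0 lambda Y A e :
  0 <= inverse_cover_measure lambda Y A e.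
Proof.
rewrite inverse_cover_measureE; apply: le_ereal_sup_tmp.
exists (inverse_cover_sum 0 lambda Y A e); last exact: inverse_cover_sum_ge0.
by exists 0%N.
Qed.

(* Enlarging the radius of every ball of a cover keeps its lengths; distinct
   balls may become equal, which can only decrease the sum. *)
Lemma inverse_cover_sum_radius N lambda Y A e e' : (e <= e')%R ->
  inverse_cover_sum N lambda Y A e' <= inverse_cover_sum N lambda Y A e.
Proof.
move=> ee'; apply: le_ereal_inf_tmp => _ [F [FA FN YF] <-].
have /choice[h hP] (B : nat * set X) : exists B' : nat * set X, F B ->
    [/\ B'.1 = B.1, inverse_balls A e' B' & B.2 `<=` B'.2].
  have [/FA[m [x [m1 Ax ->]]]|nFB] := pselect (F B); last by exists B.
  exists (m, inverse_bowen_ball m x e') => _; split=> //; first by exists m, x.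
  by move=> y [z [zy xz]]; exists z; split=> // i /xz /lt_le_trans; apply.
apply: (@le_trans _ _ (\esum_(B in h @` F) (expR (- lambda * B.1%:R))%:E)).
  apply: ereal_inf_lbound; exists (h @` F) => //; split.
  - by move=> _ [B FB <-]; have [] := hP B FB.
  - by move=> _ [B FB <-]; have [-> _ _] := hP B FB; exact: FN.
  - move=> y /YF[B FB By]; exists (h B); first by exists B.
    by have [_ _] := hP B FB; exact.
apply: (le_trans (esum_image_le _ _ _)); apply: le_esum => B FB.
by have [-> _ _] := hP B FB.
Qed.

(** Every [lambda] whose cover measure vanishes at radius [e] also has vanishing cover measure at
    [e'], so the infimum at [e'] runs over a larger set. *)
Lemma inverse_entropy_at_radius Y A e e' : (e <= e')%R ->
  inverse_entropy_at Y A e' <= inverse_entropy_at Y A e.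
Proof.
move=> ee'; apply: ereal_inf_le_tmp => _ [lambda [lambda0 me0] <-].
exists lambda => //; split=> //; apply/eqP.
rewrite eq_le inverse_cover_measure_ge0 andbT -me0 !inverse_cover_measureE.
apply: ge_ereal_sup => _ [N _ <-]; apply: le_ereal_sup_tmp.
exists (inverse_cover_sum N lambda Y A e); first by exists N.
exact: inverse_cover_sum_radius.
Qed.

(** The limit is a supremum over radii, so a lower bound at one radius suffices. *)
Lemma inverse_entropy_at_le Y A e : (0 < e)%R ->
  inverse_entropy_at Y A e <= inverse_entropy Y A.
Proof.
move=> e0; rewrite /inverse_entropy nonincreasing_at_right0_lim; last first.
  by move=> r r' _; exact: inverse_entropy_at_radius.
by apply: ereal_sup_ubound; exists e.
Qed.

End inverse_entropy_monotone.

(** * From local entropy to ball masses, and from ball masses to covers *)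

Section entropy_bounds.
Context (R : realType) (X : pmetricType R) (f : X -> X).
Hypotheses (cX : compact [set: X]) (cf : continuous f).
Variable mu : {measure set (borel X) -> \bar R}.
Local Open Scope ereal_scope.

Lemma lower_inverse_entropy_gt (x : inverse_limit f) (c : R) :
  c%:E < lower_inverse_entropy mu x ->
  exists k, forall n, (k <= n)%N -> (0 < n)%N ->
    mu (inverse_bowen_ball n x k.+1%:R^-1) <= (expR (- (c * n%:R)))%:E.
Proof.
rewrite /lower_inverse_entropy nonincreasing_at_right0_lim; last first.
  move=> e e' _ ee'; apply: le_limn_einf => n.
  apply: lee_wpmul2r; first by rewrite inve_ge0.
  rewrite leeN2 lee_lne ?in_itv/= ?measure_ge0 ?leey//.
  apply: le_measure; last exact: subset_inverse_bowen_ball.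
  - by apply: mem_set; exact: inverse_bowen_ball_measurable.
  - by apply: mem_set; exact: inverse_bowen_ball_measurable.
move=> /ereal_sup_gt[_ [e /= e0 <-]] /lt_limn_einf[N cN].
have [k _ /(_ k (leqnn k))/= ke] := near_infty_natSinv_lt (PosNum e0).
(* A single index serves as length threshold (at least [N]) and as radius index (radius below
   [e]). *)
exists (maxn N k) => n; rewrite geq_max => /andP[Nn kn] n0.
apply: le_trans (lneN_div_gt n0 (measure_ge0 _ _) (cN n Nn)).
apply: le_measure.
- by apply: mem_set; exact: inverse_bowen_ball_measurable.
- by apply: mem_set; exact: inverse_bowen_ball_measurable.
apply: subset_inverse_bowen_ball; rewrite (le_trans _ (ltW ke))//.
by rewrite lef_pV2 ?posrE// ler_nat ltnS leq_max leqnn orbT.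
Qed.

(** Mass distribution principle: for [lambda < c] every admissible cover has total weight at least
    [m]. The mass of the projection of [A] is expressed through its measurable supersets [U], since
    the projection need not be Borel. *)
Lemma inverse_entropy_at_ge (A : set (inverse_limit f)) (e c : R) N (m : \bar R) :
  0 < m ->
  (forall U : set (borel X), measurable U -> past 0 @` A `<=` U -> m <= mu U) ->
  (forall x n, A x -> (N <= n)%N -> (0 < n)%N ->
    mu (inverse_bowen_ball n x e) <= (expR (- (c * n%:R)))%:E) ->
  c%:E <= inverse_entropy_at (past 0 @` A) A e.
Proof.
move=> m0 mA muB; apply: le_ereal_inf_tmp => _ [lambda [lambda0 me0] <-].
rewrite lee_fin leNgt; apply/negP => lc.
suff : m <= inverse_cover_measure lambda (past 0 @` A) A e.
  by rewrite me0 leNgt m0.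
rewrite inverse_cover_measureE; apply: le_ereal_sup_tmp.
exists (inverse_cover_sum N lambda (past 0 @` A) A e); first by exists N.
apply: le_ereal_inf_tmp => _ [F [FA FN AF] <-].
(* Infinite weight is trivially enough; finite weight makes the union of the cover measurable and
   bounds its measure. *)
have [->|Foo] := eqVneq (\esum_(B in F) (expR (- lambda * B.1%:R))%:E) +oo.
  by rewrite leey.
have [||||mU muU] := @measure_bigcup_le_esum_levels R _ _ mu _ F fst
  (fun B => B.2 : set (borel X)) (fun n => expR (- lambda * n%:R)).
- by move=> n; rewrite expR_gt0.
- by move=> B /FA[n [x [_ _ ->]]]; exact: inverse_bowen_ball_measurable.
- move=> B FB; have /FA[n [x [n0 Ax BE]]] := FB.
  have := FN _ FB; rewrite BE/= => Nn; apply: (le_trans (muB x n Ax Nn n0)).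
  by rewrite lee_fin ler_expR mulNr lerN2 ler_wpM2r// ltW.
- by rewrite ltey.
apply: le_trans muU; apply: mA => // y Ay.
by apply: AF; split.
Qed.

End entropy_bounds.

(** * Exhaustion of [Y] by sets with uniform ball estimates *)

Theorem theorem1p8 (R : realType) (X : pmetricType R) (f : X -> X)
    (cX : compact [set: X]) (cf : continuous f)
    (mu : probability (borel X) R)
    (mu_inv : invariant_measure mu f) (mu_erg : ergodic_measure mu f)
    (muhat : probability (borel (natural_extension cX cf)) R)
    (muhat_inv : invariant_measure muhat (@inverse_limit_map X f))
    (muhat_erg : ergodic_measure muhat (@inverse_limit_map X f))
    (muhat_mu : forall B : set (borel X), measurable B ->
       pushforward muhat (past 0 : borel (natural_extension cX cf) -> borel X) B
       = mu B)
    (Y : set (borel (natural_extension cX cf))) (mY : measurable Y)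
    (Y_gt0 : (0 < muhat Y)%E)
    (alpha : R) (alpha_gt0 : 0 < alpha)
    (Y_entropy : forall x, Y x -> (alpha%:E <= lower_inverse_entropy mu x)%E) :
  (alpha%:E <=
    lim (ereal_sup [set generalized_inverse_entropy A | A in
          [set A : set (inverse_limit f) |
            [/\ completed_algebra_gen muhat A, A `<=` Y &
                (@completed_measure_extension _ _ _ muhat (Y `\` A) < delta%:E)%E]]]
         @[delta --> (0 : R)^'+]))%E.
Proof.
(* The supremum grows with [delta], so the limit is an infimum and a fixed [delta] can be
   treated. *)
rewrite nondecreasing_at_right0_lim; last first.
  move=> d d' _ dd'; apply: ereal_sup_le => _ [A [mA AY Ad] <-]; exists A => //.
  by split=> //; apply: lt_le_trans Ad _; rewrite lee_fin.
apply: le_ereal_inf_tmp => _ [delta /= delta0 <-].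
apply/lee_subgt0Pr => eta eta0; rewrite -EFinB; set c := alpha - eta.
pose G k : set (borel (natural_extension cX cf)) := [set x : inverse_limit f |
  forall n, (k <= n)%N -> (0 < n)%N ->
    (mu (inverse_bowen_ball n x k.+1%:R^-1) <= (expR (- (c * n%:R)))%:E)%E].
have mG k : measurable (G k).
  have -> : G k = \bigcap_(n in [set n | (k <= n)%N /\ (0 < n)%N]) ~`
      [set x : inverse_limit f | ((expR (- (c * n%:R)))%:E <
         mu (inverse_bowen_ball n x k.+1%:R^-1))%E].
    apply/seteqP; split=> [x Gx n [kn n0] /=|x Gx n kn n0].
      by apply/negP; rewrite -leNgt; exact: Gx.
    by have /negP := Gx n (conj kn n0); rewrite -leNgt.
  apply: bigcap_measurable => [|n _]; first by exists k.+1; split=> //=; exact: leqnSn.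
  apply: measurableC.
  by apply: sub_sigma_algebra; exact: open_inverse_bowen_ball_gt.
have mpast : measurable_fun setT
    (past 0 : borel (natural_extension cX cf) -> borel X).
  apply: (@measurability _ _ (borel (natural_extension cX cf)) (borel X) setT
    (past 0 : borel (natural_extension cX cf) -> borel X) (@open X)) => // _ [U oU <-]; rewrite setTI.
  apply: sub_sigma_algebra; apply: open_comp => // x _; exact: past_continuous.
have ndG k l : (k <= l)%N -> G k `<=` G l.
  move=> kl x Gx n ln n0; apply: le_trans (Gx n (leq_trans kl ln) n0).
  apply: le_measure.
  - by apply: mem_set; exact: inverse_bowen_ball_measurable.
  - by apply: mem_set; exact: inverse_bowen_ball_measurable.
  by apply: subset_inverse_bowen_ball; rewrite lef_pV2 ?posrE// ler_nat.
(* The loss of [eta] gives the strict inequality that places each point of [Y] in some [G k]. *)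
have YG : \bigcap_k (Y `\` G k) = set0.
  apply/seteqP; split=> // x YGx; have [Yx _] := YGx 0%N I.
  have : (c%:E < lower_inverse_entropy mu x)%E.
    by apply: lt_le_trans (Y_entropy _ Yx); rewrite lte_fin gtrBl.
  by move=> /(lower_inverse_entropy_gt cX cf)[k /((YGx k I).2)].
have cvYG : (muhat \o (fun k => Y `\` G k)) @ \oo --> 0%E.
  rewrite -(measure0 muhat) -YG; apply: nonincreasing_cvg_mu.
  - by rewrite (le_lt_trans (probability_le1 _ _)) ?ltry//; exact: measurableD.
  - by move=> k; exact: measurableD.
  - by rewrite YG.
  - by move=> k l kl; apply/subsetPset => x [Yx nGx]; split=> // /(ndG _ _ kl).
(* The bound by [delta] makes [A] admissible; the bound by [muhat Y] keeps its mass positive. *)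
have [k] : exists k, (muhat (Y `\` G k) < mine delta%:E (muhat Y))%E.
  apply: contrapT => /forallNP YGk.
  have : (mine delta%:E (muhat Y) <= 0)%E.
    rewrite -(cvg_lim _ cvYG)//; apply: lime_ge; first exact: cvgP cvYG.
    by apply: nearW => k; rewrite leNgt; apply/negP; exact: YGk.
  by rewrite leNgt lt_min lte_fin delta0 Y_gt0.
rewrite lt_min => /andP[YGdelta YGY].
pose A := Y `&` G k; have mA : measurable A by exact: measurableI.
have YA : Y `\` A = Y `\` G k by rewrite setDIr setDv set0U.
have A0 : (0 < muhat A)%E.
  rewrite lt0e measure_ge0 andbT; apply/eqP => A0.
  have : (muhat Y <= muhat (Y `\` G k))%E.
    rewrite (measureDI muhat mY (mG k)) -[leRHS]adde0; apply: leeD2l.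
    by rewrite -A0.
  by rewrite leNgt YGY.
apply: le_ereal_sup_tmp; exists (generalized_inverse_entropy (A : set (inverse_limit f))).
  exists A => //; split.
  - by exists A => //; exists set0; [exact: negligible_set0|rewrite setU0].
  - exact: subIsetl.
  (* On Borel sets the completed measure agrees with [muhat]. *)
  - rewrite YA /completed_measure_extension measurable_mu_extE//.
    exact: measurableD.
apply: le_trans (@inverse_entropy_at_le _ _ _ _ _ k.+1%:R^-1 _).
  apply: (@inverse_entropy_at_ge _ _ _ cX cf mu A _ c k (muhat A) A0).
    (* [A] lies in the preimage of [U] under the projection, whose [muhat]-measure is [mu U]. *)
    move=> U mU AU.
    apply: (@le_trans _ _ (pushforward muhat
      (past 0 : borel (natural_extension cX cf) -> borel X) U)); last first.
      by have /eqP := muhat_mu U mU; rewrite eq_le => /andP[].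
    apply: le_measure.
    - exact: mem_set.
    - by apply: mem_set; rewrite -[X in measurable X]setTI; exact: mpast.
    by move=> x Ax; apply: AU; exists x.
  by move=> x n [_ Gx]; exact: Gx.
by rewrite invr_gt0.
Qed.
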